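(* Let $X$ be a topological space, $\mathcal{A}$ a sheaf of unital commutative and associative $\mathbb{K}$-algebras over $X$ ($\mathbb{K}=\mathbb{R}$ or $\mathbb{C}$), and $k,n\in\mathbb{N}$ with $k\le n$. Then the global sections of the $k$-th Grassmann sheaf $\mathcal{G}_{\mathcal{A}}(k,n)$ coincide, up to isomorphism, with the vector subsheaves of $\mathcal{A}^n$ of rank $k$. That is, the map $\mathcal{S}\mapsto\sigma_{\mathcal{S}}$, from the set of subsheaves $\mathcal{S}$ of $\mathcal{A}^n$ that are vector sheaves of rank $k$ over $X$ to the set $\mathcal{G}_{\mathcal{A}}(k,n)(X)$ of global sections, is a bijection.
   Context: An $\mathcal{A}$-module is a sheaf $\mathcal{E}$ over $X$ whose stalks $\mathcal{E}_x$ are $\mathcal{A}_x$-modules with continuous addition and scalar multiplication (i.e. a sheaf of $\mathcal{A}$-modules). A vector sheaf of rank $k$ over an open set $U\subseteq X$ is an $\mathcal{A}|_U$-module $\mathcal{E}$ that is locally isomorphic to $\mathcal{A}^k$: there are an open covering $\{U_\alpha\}_{\alpha\in I}$ of $U$ and $\mathcal{A}|_{U_\alpha}$-isomorphisms $\mathcal{E}|_{U_\alpha}\to\mathcal{A}^k|_{U_\alpha}$. ''Subsheaf'' of an $\mathcal{A}$-module means $\mathcal{A}$-submodule sheaf. For open $U\subseteq X$ put $G_{\mathcal{A}}(k,n)(U):=\{\mathcal{S}\text{ subsheaf of }\mathcal{A}^n|_U : \mathcal{S}\cong\mathcal{A}^k|_U\}$, the set of free submodules of $\mathcal{A}^n|_U$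 of rank $k$. With the restrictions $\mathcal{S}\mapsto\mathcal{S}|_V$ ($V\subseteq U$ open) this is a presheaf of sets $G_{\mathcal{A}}(k,n)$. The $k$-th Grassmann sheaf of $\mathcal{A}^n$, $\mathcal{G}_{\mathcal{A}}(k,n)$, is the sheaf generated by (the sheafification of) this presheaf. If $\mathcal{S}$ is a subsheaf of $\mathcal{A}^n$ which is a vector sheaf of rank $k$ over $X$, then $\sigma_{\mathcal{S}}$ denotes the global section of $\mathcal{G}_{\mathcal{A}}(k,n)$ whose value at $x\in X$ is the germ at $x$ of $\mathcal{S}|_V\in G_{\mathcal{A}}(k,n)(V)$, for any open neighbourhood $V$ of $x$ over which $\mathcal{S}$ is free. *)

(* Defs.v *)
From HB Require Import structures.
From mathcomp Require Import all_boot all_order all_algebra.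
From mathcomp Require Import boolp classical_sets reals topology.
From mathcomp Require Import complex.

Set Implicit Arguments.
Unset Strict Implicit.
Unset Printing Implicit Defensive.

Import Order.TTheory GRing.Theory Num.Theory.
Local Open Scope classical_set_scope.
Local Open Scope ring_scope.

Variant scalars := RealScalars | ComplexScalars.

Definition scalar_field (R : realType) (c : scalars) : fieldType :=
  match c with
  | RealScalars => R
  | ComplexScalars => (complex R : fieldType)
  end.

(* Unital commutative associative K-algebras.  MathComp's [comAlgType] imposes
   1 != 0, which no sheaf of algebras satisfies: its algebra of sections over
   the empty set is zero. *)
Record comAlgebra (K : pzRingType) := ComAlgebra {
  alg_ring :> comPzRingType;
  alg_scale : K -> alg_ring -> alg_ring;
  alg_scaleA : forall a b u, alg_scale a (alg_scale b u) = alg_scale (a * b) u;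
  alg_scale1 : forall u, alg_scale 1 u = u;
  alg_scaleDr : forall a u v,
    alg_scale a (u + v) = alg_scale a u + alg_scale a v;
  alg_scaleDl : forall a b u,
    alg_scale (a + b) u = alg_scale a u + alg_scale b u;
  alg_scaleAl : forall a u v, alg_scale a (u * v) = alg_scale a u * v
}.

Record submodule (R : pzRingType) (E : lmodType R) := Submodule {
  smset : set E;
  smset0 : smset 0;
  smset_lin : forall a u v, smset u -> smset v -> smset (a *: u + v)
}.

Lemma submodule_ext (R : pzRingType) (E : lmodType R) (S T : submodule E) :
  smset S = smset T -> S = T.
Proof.
case: S T => [s s0 sl] [t t0 tl] /= st; subst t.
by rewrite (Prop_irrelevance s0 t0) (Prop_irrelevance sl tl).
Qed.

Definition smpred (R : pzRingType) (E : lmodType R) (S : submodule E) :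
  {pred E} := fun x => `[< smset S x >].

Lemma smpred_closed (R : pzRingType) (E : lmodType R) (S : submodule E) :
  subsemimod_closed (smpred S).
Proof.
apply: GRing.submod_closed_semi; split.
  by apply/asboolP; exact: smset0.
by move=> a u v /asboolP Su /asboolP Sv; apply/asboolP; exact: smset_lin.
Qed.

HB.instance Definition _ (R : pzRingType) (E : lmodType R) (S : submodule E) :=
  GRing.isSubmodClosed.Build R E (smpred S) (smpred_closed S).

(* A submodule as a module in its own right. *)
Definition smtype (R : pzRingType) (E : lmodType R) (S : submodule E) : Type :=
  {x : E | x \in smpred S}.

HB.instance Definition _ (R : pzRingType) (E : lmodType R) (S : submodule E) :=
  SubChoice.on (smtype S).
HB.instance Definition _ (R : pzRingType) (E : lmodType R) (S : submodule E) :=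
  [SubChoice_isSubLmodule of smtype S by <:].



Record opens (X : topologicalType) := Opens {
  oset :> set X;
  oset_open : open oset
}.

Definition whole (X : topologicalType) : opens X := Opens openT.

Definition opensI (X : topologicalType) (U V : opens X) : opens X :=
  Opens (openI (oset_open U) (oset_open V)).

(* Transparent, so that restricting twice is, up to conversion, restricting
   along the composite inclusion. *)
Definition sub_trans (X : topologicalType) (U V W : opens X)
  (hVU : V `<=` U) (hWV : W `<=` V) : W `<=` U :=
  fun x hx => hVU x (hWV x hx).

Definition subIl (X : topologicalType) (U V : opens X) :
  opensI U V `<=` U := @subIsetl X U V.

Definition subIr (X : topologicalType) (U V : opens X) :
  opensI U V `<=` V := @subIsetr X U V.

(* The sheaf axiom, for a presheaf [P] of sets on the open subspace [B]: it is
   indexed by the opens of X contained in B. *)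
Definition sheaf_axiom (X : topologicalType) (B : opens X)
    (P : forall V : opens X, V `<=` B -> Type)
    (res : forall (V W : opens X) (hV : V `<=` B) (hW : W `<=` B),
        W `<=` V -> P V hV -> P W hW) : Prop :=
  forall (V : opens X) (hV : V `<=` B) (I : Type) (C : I -> opens X)
    (hC : forall i, C i `<=` V),
  V `<=` \bigcup_i C i ->
  forall t : (forall i, P (C i) (sub_trans hV (hC i))),
  (forall i j,
      res _ (opensI (C i) (C j)) _ (sub_trans (sub_trans hV (hC i)) (@subIl _ _ _))
        (@subIl _ _ _) (t i) =
      res _ (opensI (C i) (C j)) _ (sub_trans (sub_trans hV (hC i)) (@subIl _ _ _))
        (@subIr _ _ _) (t j)) ->
  exists! s : P V hV, forall i, res _ _ hV (sub_trans hV (hC i)) (hC i) s = t i.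


Record presheaf (X : topologicalType) := Presheaf {
  psec :> opens X -> Type;
  pres : forall U V : opens X, V `<=` U -> psec U -> psec V;
  pres_id : forall (U : opens X) (h : U `<=` U) s, pres h s = s;
  pres_comp : forall (U V W : opens X) (h : V `<=` U) (h' : W `<=` V)
    (h'' : W `<=` U) s, pres h' (pres h s) = pres h'' s
}.

Definition is_sheaf (X : topologicalType) (P : presheaf X) : Prop :=
  @sheaf_axiom X (whole X) (fun V _ => P V) (fun V W _ _ h => pres h).

(* Pairs (U, s) with s a section over U identified at x: the germ of s is the
   set of all pairs (V, t) such that s and t agree near x. *)
Definition germ_set (X : topologicalType) (P : presheaf X) (x : X)
    (U : opens X) (s : P U) : set {V : opens X & P V} :=
  [set p : {V : opens X & P V} | exists (W : opens X) (hU : W `<=` U) (hV : W `<=` projT1 p),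
      oset W x /\ pres hU s = pres hV (projT2 p)].

Record stalk (X : topologicalType) (P : presheaf X) (x : X) := Stalk {
  stalk_class : set {V : opens X & P V};
  stalk_classP : exists (U : opens X) (s : P U),
    oset U x /\ stalk_class = germ_set x s
}.

Definition germ (X : topologicalType) (P : presheaf X) (x : X) (U : opens X)
    (hx : oset U x) (s : P U) : stalk P x :=
  Stalk (ex_intro _ U (ex_intro _ s (conj hx erefl))).

Lemma stalk_ext (X : topologicalType) (P : presheaf X) (x : X)
  (a b : stalk P x) : stalk_class a = stalk_class b -> a = b.
Proof.
by case: a b => [a pa] [b pb] /= ab; subst b; rewrite (Prop_irrelevance pa pb).
Qed.

Lemma germ_res (X : topologicalType) (P : presheaf X) (x : X) (U V : opens X)
  (hU : oset U x) (hV : oset V x) (h : V `<=` U) (s : P U) :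
  germ hV (pres h s) = germ hU s.
Proof.
apply: stalk_ext => /=; apply/seteqP; split=> -[W t] /= [Z] [h1] [h2] [Zx e].
  exists Z, (sub_trans h h1), h2; split=> //.
  by rewrite -e (pres_comp h h1 (sub_trans h h1)).
exists (opensI Z V), (@subIr _ _ _), (sub_trans h2 (@subIl _ _ _)); split=> //.
rewrite (pres_comp _ _ (sub_trans h1 (@subIl _ _ _))).
by rewrite -(pres_comp h1 (@subIl _ _ _)) e (pres_comp _ _ (sub_trans h2 (@subIl _ _ _))).
Qed.

(* Sections over U of the generated sheaf: families of germs over U that are
   locally induced by sections of P. *)
Record shsec (X : topologicalType) (P : presheaf X) (U : opens X) := ShSec {
  shval :> forall x, oset U x -> stalk P x;
  shloc : forall x, oset U x ->
    exists (V : opens X) (hV : V `<=` U) (t : P V),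
      oset V x /\ forall y (hy : oset V y), shval (hV y hy) = germ hy t
}.

Lemma shsec_ext (X : topologicalType) (P : presheaf X) (U : opens X)
  (s t : shsec P U) : (forall x (hx : oset U x), s x hx = t x hx) -> s = t.
Proof.
case: s t => [s ps] [t pt] /= st.
have e : s = t.
  by apply: functional_extensionality_dep => x;
    apply: functional_extensionality_dep => hx; exact: st.
by subst t; rewrite (Prop_irrelevance ps pt).
Qed.

Lemma shres_loc (X : topologicalType) (P : presheaf X) (U V : opens X)
  (h : V `<=` U) (s : shsec P U) (x : X) : oset V x ->
  exists (W : opens X) (hW : W `<=` V) (t : P W),
    oset W x /\ forall y (hy : oset W y), s y (h y (hW y hy)) = germ hy t.
Proof.
move=> Vx; have [W [hW [t [Wx st]]]] := shloc s (h x Vx).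
exists (opensI W V), (@subIr _ _ _), (pres (@subIl _ W V) t); split=> // y hy.
rewrite (germ_res (proj1 hy)) -st.
by congr (s y _); exact: Prop_irrelevance.
Qed.

Definition shres (X : topologicalType) (P : presheaf X) (U V : opens X)
    (h : V `<=` U) (s : shsec P U) : shsec P V :=
  @ShSec X P V (fun x hx => s x (h x hx)) (shres_loc h s).

Lemma shres_id (X : topologicalType) (P : presheaf X) (U : opens X)
  (h : U `<=` U) (s : shsec P U) : shres h s = s.
Proof.
by apply: shsec_ext => x hx /=; congr (s x _); exact: Prop_irrelevance.
Qed.

Lemma shres_comp (X : topologicalType) (P : presheaf X) (U V W : opens X)
  (h : V `<=` U) (h' : W `<=` V) (h'' : W `<=` U) (s : shsec P U) :
  shres h' (shres h s) = shres h'' s.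
Proof.
by apply: shsec_ext => x hx /=; congr (s x _); exact: Prop_irrelevance.
Qed.

Definition sheafification (X : topologicalType) (P : presheaf X) : presheaf X :=
  Presheaf (@shres_id X P) (@shres_comp X P).

Lemma sheafification_is_sheaf (X : topologicalType) (P : presheaf X) :
  is_sheaf (sheafification P).
Proof.
move=> V hV I C hC cov t tt.
have tE i j x (hi : oset (C i) x) (hj : oset (C j) x) : t i x hi = t j x hj.
  have /(congr1 (fun s : shsec P (opensI (C i) (C j)) => s x (conj hi hj))) := tt i j => /= e.
  rewrite (Prop_irrelevance hi (@subIl _ (C i) (C j) x (conj hi hj))) e.
  by congr (t j x _); exact: Prop_irrelevance.
have ix x (hx : oset V x) : {i | oset (C i) x}.
  by apply: cid; have [i _ Cx] := cov x hx; exists i.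
pose v x (hx : oset V x) : stalk P x := t (sval (ix x hx)) x (svalP (ix x hx)).
have vE i x (hx : oset V x) (hi : oset (C i) x) : v x hx = t i x hi by exact: tE.
have vloc x : oset V x ->
    exists (W : opens X) (hW : W `<=` V) (u : P W),
      oset W x /\ forall y (hy : oset W y), v y (hW y hy) = germ hy u.
  move=> hx; have [i _ Cx] := cov x hx.
  have [W [hW [u [Wx tu]]]] := shloc (t i) Cx.
  exists W, (sub_trans (hC i) hW), u; split=> // y hy.
  by rewrite (vE i y _ (hW y hy)) tu.
exists (ShSec vloc); split=> [i|s' hs'].
  by apply: shsec_ext => x hx /=; exact: vE.
apply: shsec_ext => x hx /=; have [i _ Cx] := cov x hx.
rewrite (vE i x hx Cx) -(hs' i) /=.
by congr (s' x _); exact: Prop_irrelevance.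
Qed.


Record algSheaf (K : pzRingType) (X : topologicalType) := AlgSheaf {
  asec :> opens X -> comAlgebra K;
  ares : forall U V : opens X, V `<=` U -> {rmorphism asec U -> asec V};
  aresZ : forall (U V : opens X) (h : V `<=` U) (a : K) (s : asec U),
    ares h (alg_scale a s) = alg_scale a (ares h s);
  ares_id : forall (U : opens X) (h : U `<=` U) s, ares h s = s;
  ares_comp : forall (U V W : opens X) (h : V `<=` U) (h' : W `<=` V)
    (h'' : W `<=` U) s, ares h' (ares h s) = ares h'' s;
  ares_sheaf : @sheaf_axiom X (whole X) (fun V _ => asec V)
    (fun V W _ _ h => ares h)
}.

(* Sheaves of modules over A|_B. *)
Record modSheaf (K : pzRingType) (X : topologicalType) (A : algSheaf K X)
    (B : opens X) := ModSheaf {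
  msec : forall V : opens X, V `<=` B -> lmodType (A V);
  mres : forall (V W : opens X) (hV : V `<=` B) (hW : W `<=` B),
    W `<=` V -> msec hV -> msec hW;
  mres_lin : forall (V W : opens X) (hV : V `<=` B) (hW : W `<=` B)
    (h : W `<=` V) (a : A V) (s t : msec hV),
    mres hW h (a *: s + t) = ares A h a *: mres hW h s + mres hW h t;
  mres_id : forall (V : opens X) (hV : V `<=` B) (h : V `<=` V) (s : msec hV),
    mres hV h s = s;
  mres_comp : forall (V W Z : opens X) (hV : V `<=` B) (hW : W `<=` B)
    (hZ : Z `<=` B) (h : W `<=` V) (h' : Z `<=` W) (h'' : Z `<=` V)
    (s : msec hV), mres hZ h' (mres hW h s) = mres hZ h'' s;
  mres_sheaf : @sheaf_axiom X B (fun V hV => msec hV)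
    (fun V W hV hW h => mres hW h)
}.

Definition mod_iso (K : pzRingType) (X : topologicalType) (A : algSheaf K X)
    (B : opens X) (E F : modSheaf A B) : Prop :=
  exists f : forall (V : opens X) (hV : V `<=` B),
      {linear msec E hV -> msec F hV},
    (forall (V W : opens X) (hV : V `<=` B) (hW : W `<=` B) (h : W `<=` V)
        (s : msec E hV), f W hW (mres hW h s) = mres hW h (f V hV s)) /\
    (forall (V : opens X) (hV : V `<=` B), bijective (f V hV)).

Section Restriction.
Variables (K : pzRingType) (X : topologicalType) (A : algSheaf K X).
Variables (B U : opens X) (E : modSheaf A B) (hU : U `<=` B).

Let sec (V : opens X) (hV : V `<=` U) : lmodType (A V) :=
  msec E (sub_trans hU hV).

Let res (V W : opens X) (hV : V `<=` U) (hW : W `<=` U) (h : W `<=` V)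
  (s : sec hV) : sec hW := mres (sub_trans hU hW) h s.

Lemma mrestr_sheaf :
  @sheaf_axiom X U (fun V hV => sec hV) (fun V W hV hW h => @res V W hV hW h).
Proof.
exact (fun V hV I C hC => @mres_sheaf K X A B E V (sub_trans hU hV) I C hC).
Qed.

(* E|_U *)
Definition mrestr : modSheaf A U :=
  @ModSheaf K X A U sec res
    (fun V W hV hW h a s t => mres_lin _ h a s t)
    (fun V hV h s => mres_id h s)
    (fun V W Z hV hW hZ h h' h'' s => mres_comp _ _ h h' h'' s)
    mrestr_sheaf.

End Restriction.

Section Free.
Variables (K : pzRingType) (X : topologicalType) (A : algSheaf K X).
Variables (n : nat) (B : opens X).

Definition rowres (V W : opens X) (h : W `<=` V) (u : 'rV[A V]_n) :
  'rV[A W]_n := map_mx (ares A h) u.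

Lemma rowres_lin (V W : opens X) (h : W `<=` V) (a : A V) (u v : 'rV[A V]_n) :
  rowres h (a *: u + v) = ares A h a *: rowres h u + rowres h v.
Proof. by apply/rowP => j; rewrite !mxE rmorphD rmorphM. Qed.

Lemma rowres_id (V : opens X) (h : V `<=` V) (u : 'rV[A V]_n) : rowres h u = u.
Proof. by apply/rowP => j; rewrite !mxE ares_id. Qed.

Lemma rowres_comp (V W Z : opens X) (h : W `<=` V) (h' : Z `<=` W)
  (h'' : Z `<=` V) (u : 'rV[A V]_n) : rowres h' (rowres h u) = rowres h'' u.
Proof. by apply/rowP => j; rewrite !mxE (ares_comp _ _ h''). Qed.

Lemma rowres_sheaf :
  @sheaf_axiom X B (fun V _ => 'rV[A V]_n) (fun V W _ _ h => rowres h).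
Proof.
move=> V hV I C hC cov t tt.
have hT : V `<=` whole X by [].
have glue (j : 'I_n) : exists! s : A V, forall i, ares A (hC i) s = t i 0 j.
  have := @ares_sheaf K X A V hT I C hC cov (fun i => t i 0 j).
  by apply=> i i'; have /rowP/(_ j) := tt i i'; rewrite !mxE.
have [s sP] : {s : 'I_n -> A V | forall j, unique
    (fun s => forall i, ares A (hC i) s = t i 0 j) (s j)}.
  exists (fun j => sval (cid (glue j))) => j; exact: svalP (cid (glue j)).
exists (\row_j s j); split=> [i|u uE].
  by apply/rowP => j; rewrite !mxE; have [-> ] := sP j.
apply/rowP => j; rewrite mxE; have [_] := sP j; apply=> i.
by rewrite -(uE i) mxE.
Qed.

(* A^n|_B *)
Definition freeMod : modSheaf A B :=
  @ModSheaf K X A B (fun V _ => 'rV[A V]_n) (fun V W _ _ h => rowres h)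
    (fun V W _ _ h => rowres_lin h)
    (fun V _ h => @rowres_id V h)
    (fun V W Z _ _ _ h h' h'' => @rowres_comp V W Z h h' h'')
    rowres_sheaf.

(* A-submodule sheaves of A^n|_B. *)
Record subsheaf := Subsheaf {
  sscar : forall V : opens X, V `<=` B -> submodule 'rV[A V]_n;
  ssres : forall (V W : opens X) (hV : V `<=` B) (hW : W `<=` B)
    (h : W `<=` V) (u : 'rV[A V]_n),
    smset (sscar hV) u -> smset (sscar hW) (rowres h u);
  ssglue : forall (V : opens X) (hV : V `<=` B) (I : Type) (C : I -> opens X)
    (hC : forall i, C i `<=` V), V `<=` \bigcup_i C i ->
    forall u : 'rV[A V]_n,
    (forall i, smset (sscar (sub_trans hV (hC i))) (rowres (hC i) u)) ->
    smset (sscar hV) u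
}.

Lemma subsheaf_ext (S T : subsheaf) :
  (forall (V : opens X) (hV : V `<=` B), sscar S hV = sscar T hV) -> S = T.
Proof.
case: S T => [s s1 s2] [t t1 t2] /= st.
have e : s = t.
  by apply: functional_extensionality_dep => V;
    apply: functional_extensionality_dep => hV; exact: st.
by subst t; rewrite (Prop_irrelevance s1 t1) (Prop_irrelevance s2 t2).
Qed.

Section SubMod.
Variable S : subsheaf.

Let sec (V : opens X) (hV : V `<=` B) : lmodType (A V) := smtype (sscar S hV).

Lemma sec_res (V W : opens X) (hV : V `<=` B) (hW : W `<=` B) (h : W `<=` V)
  (s : sec hV) : rowres h (val s) \in smpred (sscar S hW).
Proof. by apply/asboolP; apply: (ssres _ h); apply/asboolP; exact: (valP s). Qed.

Let res (V W : opens X) (hV : V `<=` B) (hW : W `<=` B) (h : W `<=` V)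
  (s : sec hV) : sec hW := Sub (rowres h (val s)) (sec_res hW h s).

Lemma submod_lin (V W : opens X) (hV : V `<=` B) (hW : W `<=` B)
    (h : W `<=` V) (a : A V) (s t : sec hV) :
  res hW h (a *: s + t) = ares A h a *: res hW h s + res hW h t.
Proof. by apply: val_inj; rewrite /= rowres_lin. Qed.

Lemma submod_id (V : opens X) (hV : V `<=` B) (h : V `<=` V) (s : sec hV) :
  res hV h s = s.
Proof. by apply: val_inj; rewrite /= rowres_id. Qed.

Lemma submod_comp (V W Z : opens X) (hV : V `<=` B) (hW : W `<=` B)
    (hZ : Z `<=` B) (h : W `<=` V) (h' : Z `<=` W) (h'' : Z `<=` V)
    (s : sec hV) : res hZ h' (res hW h s) = res hZ h'' s.
Proof. by apply: val_inj; rewrite /= (rowres_comp _ _ h''). Qed.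

Lemma submod_sheaf :
  @sheaf_axiom X B (fun V hV => sec hV) (fun V W hV hW h => @res V W hV hW h).
Proof.
move=> V hV I C hC cov t tt.
have [|s [sE su]] := @rowres_sheaf V hV I C hC cov (fun i => val (t i)).
  by move=> i j; have /(congr1 val) := tt i j.
have Ss : s \in smpred (sscar S hV).
  apply/asboolP; apply: (@ssglue S V hV I C hC cov s) => i; rewrite sE.
  by apply/asboolP; exact: (valP (t i)).
exists (Sub s Ss); split=> [i|s' hs']; first by apply: val_inj; rewrite /= sE.
by apply: val_inj => /=; apply: su => i; rewrite -hs'.
Qed.

(* A subsheaf as a sheaf of modules in its own right. *)
Definition submod : modSheaf A B :=
  ModSheaf submod_lin submod_id submod_comp submod_sheaf.

End SubMod.
End Free.

(* S|_U, for S a subsheaf of A^n|_B *)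
Definition ssrestr (K : pzRingType) (X : topologicalType) (A : algSheaf K X)
    (n : nat) (B U : opens X) (hU : U `<=` B) (S : subsheaf A n B) :
    subsheaf A n U :=
  @Subsheaf K X A n U (fun V hV => sscar S (sub_trans hU hV))
    (fun V W hV hW h u => @ssres K X A n B S V W _ _ h u)
    (fun V hV I C hC cov u => @ssglue K X A n B S V _ I C hC cov u).

Definition vector_sheaf (K : pzRingType) (X : topologicalType)
    (A : algSheaf K X) (k : nat) (B : opens X) (E : modSheaf A B) : Prop :=
  exists (I : Type) (C : I -> opens X) (hC : forall i, C i `<=` B),
    B `<=` \bigcup_i C i /\
    forall i, mod_iso (mrestr E (hC i)) (freeMod A k (C i)).


Section Grassmann.
Variables (K : pzRingType) (X : topologicalType) (A : algSheaf K X).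
Variables (k n : nat).

Definition is_free (U : opens X) (S : subsheaf A n U) : Prop :=
  mod_iso (submod S) (freeMod A k U).

Lemma is_free_restr (U V : opens X) (h : V `<=` U) (S : subsheaf A n U) :
  is_free S -> is_free (ssrestr h S).
Proof.
move=> [f [fr fb]].
exists (fun W hW => f W (sub_trans h hW)); split=> [W Z hW hZ hZW s|W hW].
  apply: etrans (fr W Z _ (sub_trans h hZ) hZW s).
  by congr (f Z _ _); exact: val_inj.
exact: fb.
Qed.

Definition gr_sec (U : opens X) : Type := {S : subsheaf A n U | is_free S}.

Definition gr_res (U V : opens X) (h : V `<=` U) (S : gr_sec U) : gr_sec V :=
  exist _ (ssrestr h (sval S)) (is_free_restr h (svalP S)).

Lemma gr_ext (U : opens X) (S T : gr_sec U) : sval S = sval T -> S = T.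
Proof.
by case: S T => [S pS] [T pT] /= e; subst T; rewrite (Prop_irrelevance pS pT).
Qed.

Lemma gr_res_id (U : opens X) (h : U `<=` U) (S : gr_sec U) : gr_res h S = S.
Proof.
apply: gr_ext; apply: subsheaf_ext => V hV /=.
by congr (sscar (sval S) _); exact: Prop_irrelevance.
Qed.

Lemma gr_res_comp (U V W : opens X) (h : V `<=` U) (h' : W `<=` V)
  (h'' : W `<=` U) (S : gr_sec U) : gr_res h' (gr_res h S) = gr_res h'' S.
Proof.
apply: gr_ext; apply: subsheaf_ext => Z hZ /=.
by congr (sscar (sval S) _); exact: Prop_irrelevance.
Qed.

(* G_A(k, n) *)
Definition grassmann_presheaf : presheaf X :=
  @Presheaf X gr_sec gr_res gr_res_id gr_res_comp.

Definition grassmann_sheaf : presheaf X := sheafification grassmann_presheaf.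

Definition vector_subsheaf : Type :=
  {S : subsheaf A n (whole X) | vector_sheaf k (submod S)}.

Record free_nbhd (S : subsheaf A n (whole X)) (x : X) := FreeNbhd {
  fn_open : opens X;
  fn_mem : oset fn_open x;
  fn_sub : fn_open `<=` whole X;
  fn_free : is_free (ssrestr fn_sub S)
}.

Definition fn_germ (S : subsheaf A n (whole X)) (x : X) (N : free_nbhd S x) :
    stalk grassmann_presheaf x :=
  germ (P := grassmann_presheaf) (fn_mem N) (exist _ _ (fn_free N)).

Lemma fn_germ_indep (S : subsheaf A n (whole X)) (x : X) (N M : free_nbhd S x) :
  fn_germ N = fn_germ M.
Proof.
case: N M => [U Ux hU fU] [V Vx hV fV]; rewrite /fn_germ /=.
have UVx : oset (opensI U V) x by [].
rewrite -(germ_res Ux UVx (@subIl _ _ _)) -(germ_res Vx UVx (@subIr _ _ _)).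
apply: (congr1 (germ (P := grassmann_presheaf) UVx)).
apply: gr_ext; apply: subsheaf_ext => W hW /=.
by congr (sscar S _); exact: Prop_irrelevance.
Qed.

Lemma vector_subsheaf_nbhd (S : vector_subsheaf) (x : X) :
  exists N : free_nbhd (sval S) x, True.
Proof.
have [I [C [hC [cov isoC]]]] := svalP S.
have [i _ Cx] := cov x Logic.I.
have fC : is_free (ssrestr (hC i) (sval S)).
  have [f [fr fb]] := isoC i; exists f; split=> [V W hV hW h s|]; last exact: fb.
  apply: etrans (fr V W hV hW h s).
  by congr (f W _ _); exact: val_inj.
by exists (FreeNbhd Cx fC).
Qed.

Definition sigma_val (S : vector_subsheaf) (x : X) :
    stalk grassmann_presheaf x :=
  fn_germ (sval (cid (vector_subsheaf_nbhd S x))).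

Lemma sigma_valE (S : vector_subsheaf) (x : X) (N : free_nbhd (sval S) x) :
  sigma_val S x = fn_germ N.
Proof. exact: fn_germ_indep. Qed.

Lemma sigma_loc (S : vector_subsheaf) (x : X) : oset (whole X) x ->
  exists (V : opens X) (hV : V `<=` whole X) (t : grassmann_presheaf V),
    oset V x /\ forall y (hy : oset V y), sigma_val S y = germ hy t.
Proof.
move=> _; have [[V Vx hV fV] _] := vector_subsheaf_nbhd S x.
exists V, hV, (exist _ _ fV); split=> // y hy.
exact: (sigma_valE (FreeNbhd hy fV)).
Qed.

(* The global section of germs x |-> [S|_V]_x, for any open neighbourhood V of
   x over which S is free. *)
Definition sigma (S : vector_subsheaf) : grassmann_sheaf (whole X) :=
  @ShSec X grassmann_presheaf (whole X) (fun x _ => sigma_val S x)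
    (sigma_loc S).

End Grassmann.

(* Main.v *)
(* Both halves of bijectivity rest on locality: membership of a section in a
   subsheaf of A^n can be tested on an open covering, and two sections of the
   Grassmann presheaf with equal germs at x coincide near x.  Hence S is
   determined by the germs of its restrictions.  Conversely, a global section s
   is sigma of the subsheaf of those u whose germ at each x lies in s(x). *)
Require Import Defs.
From mathcomp Require Import all_boot all_order all_algebra.
From mathcomp Require Import boolp classical_sets reals topology.

Set Implicit Arguments.
Unset Strict Implicit.
Unset Printing Implicit Defensive.

Local Open Scope classical_set_scope.
Local Open Scope ring_scope.

Lemma inj_surj_bij (T U : Type) (f : T -> U) :
  injective f -> (forall y, exists x, f x = y) -> bijective f.
Proof.
move=> fI fS; pose g y := sval (cid (fS y)).
have fK y : f (g y) = y by exact: svalP (cid (fS y)).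
by exists g => // x; apply: fI; rewrite fK.
Qed.

(** The pair [(V, t)] belongs to its own class, hence to the class of [s], and belonging to the
    latter means precisely agreeing with [s] near [x]. *)
Lemma germ_eq (X : topologicalType) (P : presheaf X) (x : X) (U V : opens X)
    (hU : oset U x) (hV : oset V x) (s : P U) (t : P V) :
  germ hU s = germ hV t ->
  exists (W : opens X) (WU : W `<=` U) (WV : W `<=` V),
    oset W x /\ pres WU s = pres WV t.
Proof.
move=> /(congr1 (@stalk_class _ _ _)) /= e.
have : germ_set x t (existT _ V t) by exists V, (fun y h => h), (fun y h => h).
by rewrite -e.
Qed.

Section Subsheaves.
Variables (K : pzRingType) (X : topologicalType) (A : algSheaf K X).
Variable n : nat.

(** Choosing one [Z] for each point of [V] gives an open covering of [V] indexed by its points, to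
    which the gluing axiom of [S] applies. *)
Lemma subsheaf_local (B : opens X) (S : subsheaf A n B) (V : opens X)
    (hV : V `<=` B) (u : 'rV[A V]_n) :
  (forall x, oset V x -> exists (Z : opens X) (ZV : Z `<=` V) (ZB : Z `<=` B),
     oset Z x /\ smset (sscar S ZB) (rowres ZV u)) ->
  smset (sscar S hV) u.
Proof.
move=> loc.
have pick (i : {x | oset V x}) : {Z : opens X | exists (ZV : Z `<=` V)
    (ZB : Z `<=` B), oset Z (sval i) /\ smset (sscar S ZB) (rowres ZV u)}.
  by apply: cid; exact: loc (svalP i).
have CV i : sval (pick i) `<=` V by have [] := svalP (pick i).
apply: (ssglue (C := fun i => sval (pick i)) (hC := CV)) => [x Vx|i].
  exists (exist _ x Vx) => //.
  by have [? [? []]] := svalP (pick (exist _ x Vx)).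
have [ZV [ZB [_]]] := svalP (pick i).
by rewrite (Prop_irrelevance ZV (CV i))
  (Prop_irrelevance ZB (sub_trans hV (CV i))).
Qed.

(** Sections of a subsheaf are indexed by proofs of inclusion; leaving [ZB] and [ZB'] arbitrary lets
    membership be transported whichever composite inclusions arise. *)
Lemma ssrestr_eq_mem (B B' W : opens X) (WB : W `<=` B) (WB' : W `<=` B')
    (S : subsheaf A n B) (T : subsheaf A n B') (Z : opens X) (ZW : Z `<=` W)
    (ZB : Z `<=` B) (ZB' : Z `<=` B') (u : 'rV[A Z]_n) :
  ssrestr WB S = ssrestr WB' T ->
  smset (sscar S ZB) u -> smset (sscar T ZB') u.
Proof.
move=> /(congr1 (fun Q => sscar Q ZW)) /= e.
by rewrite (Prop_irrelevance ZB (sub_trans WB ZW)) e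
  (Prop_irrelevance ZB' (sub_trans WB' ZW)).
Qed.

Lemma subsheaf_local_eq (B : opens X) (S T : subsheaf A n B) :
  (forall x, oset B x -> exists (W : opens X) (h h' : W `<=` B),
     oset W x /\ ssrestr h S = ssrestr h' T) ->
  S = T.
Proof.
(* The hypothesis is symmetric in the two subsheaves, so one inclusion suffices. *)
suff le (S1 T1 : subsheaf A n B) :
    (forall x, oset B x -> exists (W : opens X) (h h' : W `<=` B),
       oset W x /\ ssrestr h S1 = ssrestr h' T1) ->
    forall (V : opens X) (hV : V `<=` B),
      smset (sscar S1 hV) `<=` smset (sscar T1 hV).
  move=> loc; apply: subsheaf_ext => V hV; apply: submodule_ext.
  apply/seteqP; split; apply: le => // x Bx.
  by have [W [h [h' [Wx e]]]] := loc x Bx; exists W, h', h.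
move=> loc V hV u Su; apply: subsheaf_local => x Vx.
have [W [h [h' [Wx e]]]] := loc x (hV x Vx).
have VWB : opensI V W `<=` B := sub_trans h (@subIr _ V W).
exists (opensI V W), (@subIl _ V W), VWB; split=> //.
apply: (ssrestr_eq_mem (ZB := VWB) (@subIr _ V W) _ e).
exact: ssres Su.
Qed.

Variable k : nat.
Local Notation G := (grassmann_presheaf A k n).

Lemma gr_germ_eq (x : X) (U V : opens X) (hU : oset U x) (hV : oset V x)
    (s : G U) (t : G V) :
  germ hU s = germ hV t ->
  exists (W : opens X) (WU : W `<=` U) (WV : W `<=` V),
    oset W x /\ ssrestr WU (sval s) = ssrestr WV (sval t).
Proof.
move=> /germ_eq[W [WU [WV [Wx /(congr1 sval) e]]]].
by exists W, WU, WV.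
Qed.

Lemma sigma_inj : injective (@sigma K X A k n).
Proof.
move=> S T eST.
suff: sval S = sval T.
  case: S T {eST} => [S pS] [T pT] /= e; subst T.
  by rewrite (Prop_irrelevance pS pT).
apply: subsheaf_local_eq => x Xx.
have := congr1 (fun s : shsec G (whole X) => s x Xx) eST; rewrite /=.
have [N _] := vector_subsheaf_nbhd S x.
have [M _] := vector_subsheaf_nbhd T x.
(* The value of sigma at [x] may be computed on any free neighbourhood, so equal values make [S] and
   [T] agree near [x]. *)
rewrite (sigma_valE N) (sigma_valE M) => /gr_germ_eq[W [WU [WV [Wx /= e]]]].
by exists W, (sub_trans (fn_sub (f := N)) WU), (sub_trans (fn_sub (f := M)) WV).
Qed.

Lemma free_cover_vector (S : subsheaf A n (whole X)) :
  (forall x, exists N : free_nbhd k S x, True) -> vector_sheaf k (submod S).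
Proof.
move=> nb; pose N x := sval (cid (nb x)).
exists X, (fun x => fn_open (N x)), (fun x => fn_sub (f := N x)); split.
  by move=> x _; exists x => //; exact: fn_mem.
move=> x; have [f [fr fb]] := fn_free (N x).
exists f; split=> [V W hV hW h s|]; last exact: fb.
(* Restricting before or after passing to modules yields the same sections up to membership proofs,
   which [val_inj] discards. *)
apply: etrans (fr V W hV hW h s).
by congr (f W _ _); exact: val_inj.
Qed.

Section GermwiseMembership.
Variable s : grassmann_sheaf A k n (whole X).

(* Quantifying over all representatives t of the germ s x, rather than over
   some, makes stability under addition immediate. *)
Definition germwise_mem (V : opens X) (u : 'rV[A V]_n) : Prop :=
  forall x (_ : oset V x) (W : opens X) (Wx : oset W x) (t : G W),
    s x Logic.I = germ Wx t ->
    exists (Z : opens X) (ZV : Z `<=` V) (ZW : Z `<=` W),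
      oset Z x /\ smset (sscar (sval t) ZW) (rowres ZV u).

Lemma germwise_mem0 (V : opens X) : germwise_mem (0 : 'rV[A V]_n).
Proof.
move=> x Vx W Wx t _.
exists (opensI V W), (@subIl _ V W), (@subIr _ V W); split=> //.
suff -> : rowres (@subIl _ V W) (0 : 'rV[A V]_n) = 0 by exact: smset0.
by apply/rowP => j; rewrite !mxE GRing.rmorph0.
Qed.

Lemma germwise_mem_lin (V : opens X) (a : A V) (u v : 'rV[A V]_n) :
  germwise_mem u -> germwise_mem v -> germwise_mem (a *: u + v).
Proof.
move=> Su Sv x Vx W Wx t st.
have [Y [YV [YW [Yx tu]]]] := Su x Vx W Wx t st.
have [Z [ZV [ZW [Zx tv]]]] := Sv x Vx W Wx t st.
exists (opensI Y Z), (sub_trans YV (@subIl _ Y Z)),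
  (sub_trans YW (@subIl _ Y Z)); split=> //.
rewrite rowres_lin; apply: smset_lin.
- rewrite -(rowres_comp YV (@subIl _ Y Z)).
  exact: ssres tu.
- rewrite -(rowres_comp ZV (@subIr _ Y Z)).
  exact: ssres tv.
Qed.

Lemma germwise_mem_res (V W : opens X) (h : W `<=` V) (u : 'rV[A V]_n) :
  germwise_mem u -> germwise_mem (rowres h u).
Proof.
move=> Su x Wx U Ux t st.
have [Z [ZV [ZU [Zx tu]]]] := Su x (h x Wx) U Ux t st.
exists (opensI Z W), (@subIr _ Z W), (sub_trans ZU (@subIl _ Z W)); split=> //.
rewrite (rowres_comp _ _ (sub_trans ZV (@subIl _ Z W))).
rewrite -(rowres_comp ZV (@subIl _ Z W)).
exact: ssres tu.
Qed.

Lemma germwise_mem_glue (V : opens X) (I : Type) (C : I -> opens X)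
    (hC : forall i, C i `<=` V) : V `<=` \bigcup_i C i ->
  forall u : 'rV[A V]_n,
  (forall i, germwise_mem (rowres (hC i) u)) -> germwise_mem u.
Proof.
move=> cov u Su x Vx W Wx t st; have [i _ Cx] := cov x Vx.
have [Z [ZC [ZW [Zx tu]]]] := Su i x Cx W Wx t st.
exists Z, (sub_trans (hC i) ZC), ZW; split=> //.
by rewrite -(rowres_comp (hC i) ZC).
Qed.

Definition germwise_subsheaf : subsheaf A n (whole X) :=
  @Subsheaf K X A n (whole X)
    (fun V _ => Submodule (@germwise_mem0 V) (@germwise_mem_lin V))
    (fun V W _ _ h => @germwise_mem_res V W h)
    (fun V _ => @germwise_mem_glue V).

(** Where [s] is induced by [t], testing against [t] itself and gluing gives one inclusion; for the
    other, any further representative of the germ agrees with [t] near the point. *)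
Lemma germwise_restr (W : opens X) (hW : W `<=` whole X) (t : G W) :
  (forall y (hy : oset W y), s y Logic.I = germ hy t) ->
  ssrestr hW germwise_subsheaf = sval t.
Proof.
move=> st; apply: subsheaf_ext => V VW; apply: submodule_ext.
apply/seteqP; split=> u /= uV.
  by apply: subsheaf_local => x Vx; exact: uV (st x (VW x Vx)).
move=> x Vx W' W'x t' st'.
(* On [Y] the representatives [t'] and [t] coincide, so membership passes from [t] to [t'] over the
   intersection of [V] and [Y]. *)
have := st x (VW x Vx); rewrite st' => /gr_germ_eq[Y [YW' [YW [Yx e]]]].
exists (opensI V Y), (@subIl _ V Y), (sub_trans YW' (@subIr _ V Y)).
split=> //; have VYW : opensI V Y `<=` W := sub_trans VW (@subIl _ V Y).
apply: (ssrestr_eq_mem (ZB := VYW) (@subIr _ V Y) _ (esym e)).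
exact: ssres uV.
Qed.

(** Near [x] the subsheaf equals a local representative [t] of [s]; this yields both its freeness
    and the value of its germ. *)
Lemma germwise_free_nbhd (x : X) :
  exists N : free_nbhd k germwise_subsheaf x, fn_germ N = s x Logic.I.
Proof.
have [W [hW [t [Wx st]]]] := shloc s (x := x) Logic.I.
have st' y (hy : oset W y) : s y Logic.I = germ hy t.
  by rewrite -st; congr (s y _); exact: Prop_irrelevance.
have e := germwise_restr hW st'.
have fr : is_free k (ssrestr hW germwise_subsheaf).
  by rewrite e; exact: svalP t.
exists (FreeNbhd Wx fr); rewrite (st' x Wx) /fn_germ.
by congr germ; exact: gr_ext.
Qed.

End GermwiseMembership.

Lemma sigma_surj (s : grassmann_sheaf A k n (whole X)) :
  exists S : vector_subsheaf A k n, sigma S = s.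
Proof.
have vS : vector_sheaf k (submod (germwise_subsheaf s)).
  apply: free_cover_vector => x.
  by have [N _] := germwise_free_nbhd s x; exists N.
pose S : vector_subsheaf A k n := exist _ (germwise_subsheaf s) vS.
exists S; apply: shsec_ext => x hx /=.
have [N eN] := germwise_free_nbhd s x.
(* Independence of the chosen neighbourhood allows sigma to be evaluated on the one whose germ is
   known to be that of [s]. *)
rewrite (sigma_valE (S := S) N) eN.
by congr (s x _); exact: Prop_irrelevance.
Qed.

End Subsheaves.

Theorem proposition2p3 (R : realType) (c : scalars) (X : topologicalType)
  (A : algSheaf (scalar_field R c) X) (k n : nat) (hkn : (k <= n)%N) :
  bijective (@sigma (scalar_field R c) X A k n).
Proof. exact: inj_surj_bij (@sigma_inj _ _ _ _ _) (@sigma_surj _ _ _ _ _). Qed.
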